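(* The Set-Fmla logic $\mathcal{PP}^{\Rightarrow_H}_{\le}$ has the extension interpolation property (EIP), but has neither the Craig interpolation property (CIP) nor the Maehara interpolation property (MIP).
   Context: $\mathbf{PP}_6^{\Rightarrow_H}$ is the algebra in signature $\Sigma=\{\land,\lor,\Rightarrow,{\sim},\circ,\bot,\top\}$ with carrier $\mathcal V_6=\{\hat{\mathbf f},\mathbf f,\mathbf n,\mathbf b,\mathbf t,\hat{\mathbf t}\}$ ordered by $\hat{\mathbf f}<\mathbf f<\mathbf n<\mathbf t<\hat{\mathbf t}$, $\mathbf f<\mathbf b<\mathbf t$, $\mathbf n,\mathbf b$ incomparable; $\land,\lor$ meet and join, $\bot=\hat{\mathbf f}$, $\top=\hat{\mathbf t}$, ${\sim}$ swaps $\mathbf f\leftrightarrow\mathbf t$, $\hat{\mathbf f}\leftrightarrow\hat{\mathbf t}$ and fixes $\mathbf n,\mathbf b$; $\circ a=\hat{\mathbf t}$ if $a\in\{\hat{\mathbf f},\hat{\mathbf t}\}$, else $\hat{\mathbf f}$; $a\Rightarrow b=\max\{c: a\land c\le b\}$. $\mathcal{PP}^{\Rightarrow_H}_{\le}$: $\Phi\vdash\psi$ iff for some finite $\Phi'\subseteq\Phi$ the inequality $\bigwedge\Phi'\le\psi$ ($\bigwedge\varnothing=\top$) holds in all members of the variety generated by $\mathbf{PP}_6^{\Rightarrow_H}$ under all assignments. For a set $S$ of variables, $L(S)$ denotes the set of $\Sigma$-formulas whose variables lie in $S$; $\mathsf{props}(\Gamma)$ is the set of variables occurring in $\Gamma$.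 A Set-Fmla logic $\vdash$ has: (EIP) if $\Phi\cup\Psi\vdash\varphi$ implies there is $\Pi\subseteq L(\mathsf{props}(\Psi\cup\{\varphi\}))$ with $\Phi\vdash\pi$ for all $\pi\in\Pi$ and $\Pi\cup\Psi\vdash\varphi$; (CIP) if, whenever $\mathsf{props}(\Phi)\cap\mathsf{props}(\varphi)\ne\varnothing$, $\Phi\vdash\varphi$ implies there is $\Pi\subseteq L(\mathsf{props}(\Phi)\cap\mathsf{props}(\varphi))$ with $\Phi\vdash\pi$ for all $\pi\in\Pi$ and $\Pi\vdash\varphi$; (MIP) if, whenever $\mathsf{props}(\Phi)\cap\mathsf{props}(\Psi\cup\{\varphi\})\ne\varnothing$, $\Phi\cup\Psi\vdash\varphi$ implies there is $\Pi\subseteq L(\mathsf{props}(\Phi)\cap\mathsf{props}(\Psi\cup\{\varphi\}))$ with $\Phi\vdash\pi$ for all $\pi\in\Pi$ and $\Pi\cup\Psi\vdash\varphi$. *)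

(* Defs.v *)
From Stdlib Require Import List Ensembles.
Import ListNotations.

Inductive formula : Type :=
| Var (p : nat)
| And (a b : formula)
| Or (a b : formula)
| Imp (a b : formula)
| Neg (a : formula)
| Circ (a : formula)
| Bot
| Top.

Record algebra : Type := Algebra {
  carrier :> Type;
  a_and : carrier -> carrier -> carrier;
  a_or : carrier -> carrier -> carrier;
  a_imp : carrier -> carrier -> carrier;
  a_neg : carrier -> carrier;
  a_circ : carrier -> carrier;
  a_bot : carrier;
  a_top : carrier
}.

Arguments a_and {_}. Arguments a_or {_}. Arguments a_imp {_}.
Arguments a_neg {_}. Arguments a_circ {_}.
Arguments a_bot {_}. Arguments a_top {_}.

Fixpoint eval (A : algebra) (v : nat -> A) (x : formula) : A :=
  match x with
  | Var p => v p
  | And a b => a_and (eval A v a) (eval A v b)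
  | Or a b => a_or (eval A v a) (eval A v b)
  | Imp a b => a_imp (eval A v a) (eval A v b)
  | Neg a => a_neg (eval A v a)
  | Circ a => a_circ (eval A v a)
  | Bot => a_bot
  | Top => a_top
  end.

Definition a_le {A : algebra} (a b : A) : Prop := a_and a b = a.

Record is_hom {A B : algebra} (h : A -> B) : Prop := IsHom {
  hom_and : forall x y, h (a_and x y) = a_and (h x) (h y);
  hom_or : forall x y, h (a_or x y) = a_or (h x) (h y);
  hom_imp : forall x y, h (a_imp x y) = a_imp (h x) (h y);
  hom_neg : forall x, h (a_neg x) = a_neg (h x);
  hom_circ : forall x, h (a_circ x) = a_circ (h x);
  hom_bot : h a_bot = a_bot;
  hom_top : h a_top = a_top
}.

Definition prod_algebra (I : Type) (F : I -> algebra) : algebra := {|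
  carrier := forall i, F i;
  a_and := fun x y i => a_and (x i) (y i);
  a_or := fun x y i => a_or (x i) (y i);
  a_imp := fun x y i => a_imp (x i) (y i);
  a_neg := fun x i => a_neg (x i);
  a_circ := fun x i => a_circ (x i);
  a_bot := fun i => a_bot;
  a_top := fun i => a_top
|}.

(* The least class of algebras containing K and closed under homomorphic
   images, subalgebras (up to isomorphism) and direct products. *)
Inductive variety (K : algebra -> Prop) : algebra -> Prop :=
| variety_gen (A : algebra) : K A -> variety K A
| variety_H (A B : algebra) (h : A -> B) :
    is_hom h -> (forall y, exists x, h x = y) -> variety K A -> variety K B
| variety_S (A B : algebra) (h : A -> B) :
    is_hom h -> (forall x y, h x = h y -> x = y) -> variety K B -> variety K A
| variety_P (I : Type) (F : I -> algebra) :
    (forall i, variety K (F i)) -> variety K (prod_algebra I F).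

(* [vFF] and [vTT] are the values written f and t with a hat. *)
Inductive V6 : Type := vFF | vf | vn | vb | vt | vTT.

Definition le6 (x y : V6) : bool :=
  match x, y with
  | vFF, _ => true
  | _, vTT => true
  | vf, (vf | vn | vb | vt) => true
  | vn, (vn | vt) => true
  | vb, (vb | vt) => true
  | vt, vt => true
  | _, _ => false
  end.

(* The only incomparable pair is n, b: its meet is f and its join is t. *)
Definition meet6 (x y : V6) : V6 :=
  if le6 x y then x else if le6 y x then y else vf.

Definition join6 (x y : V6) : V6 :=
  if le6 x y then y else if le6 y x then x else vt.

(* Computed as the join of all c with x /\ c <= y; see [imp6_max]. *)
Definition imp6 (x y : V6) : V6 :=
  fold_right join6 vFF
    (filter (fun c => le6 (meet6 x c) y) [vFF; vf; vn; vb; vt; vTT]).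

Definition neg6 (x : V6) : V6 :=
  match x with vFF => vTT | vf => vt | vn => vn | vb => vb | vt => vf | vTT => vFF end.

Definition circ6 (x : V6) : V6 :=
  match x with vFF | vTT => vTT | _ => vFF end.

Definition PP6 : algebra := {|
  carrier := V6;
  a_and := meet6;
  a_or := join6;
  a_imp := imp6;
  a_neg := neg6;
  a_circ := circ6;
  a_bot := vFF;
  a_top := vTT
|}.

Lemma le6_refl x : le6 x x = true.
Proof. now destruct x. Qed.

Lemma le6_antisym x y : le6 x y = true -> le6 y x = true -> x = y.
Proof. now destruct x, y. Qed.

Lemma le6_trans x y z : le6 x y = true -> le6 y z = true -> le6 x z = true.
Proof. now destruct x, y, z. Qed.

Lemma meet6_glb x y z :
  le6 z (meet6 x y) = true <-> le6 z x = true /\ le6 z y = true.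
Proof. destruct x, y, z; cbv; intuition congruence. Qed.

Lemma join6_lub x y z :
  le6 (join6 x y) z = true <-> le6 x z = true /\ le6 y z = true.
Proof. destruct x, y, z; cbv; intuition congruence. Qed.

Lemma imp6_max x y :
  le6 (meet6 x (imp6 x y)) y = true /\
  (forall c, le6 (meet6 x c) y = true -> le6 c (imp6 x y) = true).
Proof.
split; [now destruct x, y|].
intros c; destruct x, y, c; cbv; congruence.
Qed.

Lemma a_le_PP6 (x y : PP6) : a_le x y <-> le6 x y = true.
Proof. destruct x, y; cbv; intuition congruence. Qed.

Definition big_and (G : list formula) : formula := fold_right And Top G.

Definition logic : Type := Ensemble formula -> formula -> Prop.

Definition PPle : logic := fun Phi psi =>
  exists G : list formula,
    (forall x, List.In x G -> Ensembles.In formula Phi x) /\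
    (forall A : algebra, variety (fun B => B = PP6) A ->
     forall v : nat -> A, a_le (eval A v (big_and G)) (eval A v psi)).

Fixpoint occurs (p : nat) (x : formula) : Prop :=
  match x with
  | Var q => p = q
  | And a b | Or a b | Imp a b => occurs p a \/ occurs p b
  | Neg a | Circ a => occurs p a
  | Bot | Top => False
  end.

Definition props (G : Ensemble formula) : Ensemble nat :=
  fun p => exists x, Ensembles.In formula G x /\ occurs p x.

Definition L (S : Ensemble nat) : Ensemble formula :=
  fun x => forall p, occurs p x -> Ensembles.In nat S p.

Arguments Union {U}. Arguments Intersection {U}. Arguments Singleton {U}.
Arguments Included {U}. Arguments Inhabited {U}. Arguments Ensembles.In {U}.

Definition EIP (D : logic) : Prop :=
  forall (Phi Psi : Ensemble formula) (phi : formula),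
    D (Union Phi Psi) phi ->
    exists Pi : Ensemble formula,
      Included Pi (L (props (Union Psi (Singleton phi)))) /\
      (forall pi, Ensembles.In Pi pi -> D Phi pi) /\
      D (Union Pi Psi) phi.

Definition CIP (D : logic) : Prop :=
  forall (Phi : Ensemble formula) (phi : formula),
    Inhabited (Intersection (props Phi) (props (Singleton phi))) ->
    D Phi phi ->
    exists Pi : Ensemble formula,
      Included Pi (L (Intersection (props Phi) (props (Singleton phi)))) /\
      (forall pi, Ensembles.In Pi pi -> D Phi pi) /\
      D Pi phi.

Definition MIP (D : logic) : Prop :=
  forall (Phi Psi : Ensemble formula) (phi : formula),
    Inhabited
      (Intersection (props Phi) (props (Union Psi (Singleton phi)))) ->
    D (Union Phi Psi) phi ->
    exists Pi : Ensemble formula,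
      Included Pi
        (L (Intersection (props Phi) (props (Union Psi (Singleton phi))))) /\
      (forall pi, Ensembles.In Pi pi -> D Phi pi) /\
      D (Union Pi Psi) phi.

(* Main.v *)
From Stdlib Require Import List Ensembles FunctionalExtensionality IndefiniteDescription.
Require Import Defs.
Import ListNotations.

(** Entailment is decided in [PP6], and there the Heyting implication is
    residual to the meet.  Hence [Phi, Psi |- phi] is witnessed by
    [Phi |- /\Psi' => phi] for some finite [Psi'] inside [Psi], and the
    implication is itself the interpolant required by (EIP).

    Write [q, p, r] for the variables 0, 1, 2.  (CIP) fails because
    [{FF, n, TT}] is a subalgebra: a formula in the single
    variable [q] takes one of these three values when [q] is [n].  The formula
    [cip_left] in [q, p] is at most [f], and [cip_right] in [q, r] is at least
    [f] when [q] is neither [FF] nor [TT], so the first entails the second; at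
    [q = n], [p = r = b] both are equal to [f], and no interpolant can take
    that value.  (MIP) implies (CIP) by choosing [Psi] empty. *)

(** * Reduction to the six-element algebra *)

Lemma eval_hom (A B : algebra) (h : A -> B) (v : nat -> A) (s : formula) :
  is_hom h -> eval B (fun p => h (v p)) s = h (eval A v s).
Proof.
intros [hand hor himp hneg hcirc hbot htop].
induction s; simpl; congruence.
Qed.

Lemma eval_prod (I : Type) (F : I -> algebra) (v : nat -> prod_algebra I F)
    (s : formula) (i : I) :
  eval (prod_algebra I F) v s i = eval (F i) (fun p => v p i) s.
Proof. induction s; simpl; congruence. Qed.

(** The easy half of Birkhoff's theorem: equations survive homomorphic images, subalgebras and
    products. *)
Lemma variety_equation (K : algebra -> Prop) (s t : formula) :
  (forall A, K A -> forall v, eval A v s = eval A v t) ->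
  forall A, variety K A -> forall v, eval A v s = eval A v t.
Proof.
intros HK A HA.
induction HA as [A HA|A B h Hh surj _ IH|A B h Hh inj _ IH|I F _ IH]; intros v.
- now apply HK.
(* By choice, [v] lifts along the surjection [h]. *)
- destruct (functional_choice _ (fun p => surj (v p))) as [u Hu].
  assert (Hv : v = fun p => h (u p)) by (apply functional_extensionality; auto).
  now rewrite Hv, !eval_hom, IH by assumption.
- apply inj. now rewrite <- !eval_hom by assumption.
- apply functional_extensionality_dep; intros i.
  rewrite !eval_prod. apply IH.
Qed.

Lemma PPle_intro (Phi : Ensemble formula) (psi : formula) (G : list formula) :
  (forall x, List.In x G -> Ensembles.In Phi x) ->
  (forall v, le6 (eval PP6 v (big_and G)) (eval PP6 v psi) = true) ->
  PPle Phi psi.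
Proof.
intros HG Hle; exists G; split; [exact HG|].
intros A HA v.
(* The order is itself given by an equation. *)
change (eval A v (And (big_and G) psi) = eval A v (big_and G)).
revert A HA v; apply variety_equation.
intros A -> v; apply a_le_PP6, Hle.
Qed.

Lemma PPle_elim (Phi : Ensemble formula) (psi : formula) :
  PPle Phi psi ->
  exists G, (forall x, List.In x G -> Ensembles.In Phi x) /\
    forall v, le6 (eval PP6 v (big_and G)) (eval PP6 v psi) = true.
Proof.
intros [G [HG Hle]]; exists G; split; [exact HG|].
intros v; apply a_le_PP6, Hle. now apply variety_gen.
Qed.

Lemma le6_big_and (v : nat -> PP6) (a : V6) (G : list formula) :
  le6 a (eval PP6 v (big_and G)) = true <->
  forall x, List.In x G -> le6 a (eval PP6 v x) = true.
Proof.
induction G as [|y G IH]; simpl.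
- split; [easy|now destruct a].
- rewrite meet6_glb, IH; split.
  + intros [Hy HG] x [<-|Hx]; auto.
  + auto.
Qed.

Lemma PPle_sound (Phi : Ensemble formula) (psi : formula) (v : nat -> PP6) (a : V6) :
  PPle Phi psi ->
  (forall x, Ensembles.In Phi x -> le6 a (eval PP6 v x) = true) ->
  le6 a (eval PP6 v psi) = true.
Proof.
intros HD Ha; destruct (PPle_elim _ _ HD) as [G [HG Hle]].
apply le6_trans with (2 := Hle v). apply le6_big_and; auto.
Qed.

Lemma PPle_mono (Phi Phi' : Ensemble formula) (psi : formula) :
  Included Phi Phi' -> PPle Phi psi -> PPle Phi' psi.
Proof. intros Hinc [G [HG Hle]]; exists G; split; auto. Qed.

(** * Extension interpolation *)

Lemma imp6_residual (x y z : V6) :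
  le6 x (imp6 y z) = true <-> le6 (meet6 x y) z = true.
Proof. destruct x, y, z; cbv; intuition congruence. Qed.

Lemma list_split_union (Phi Psi : Ensemble formula) (G : list formula) :
  (forall x, List.In x G -> Ensembles.In (Union Phi Psi) x) ->
  exists G1 G2,
    (forall x, List.In x G1 -> Ensembles.In Phi x) /\
    (forall x, List.In x G2 -> Ensembles.In Psi x) /\
    (forall x, List.In x G -> List.In x (G1 ++ G2)).
Proof.
induction G as [|y G IH]; intros HG.
- exists [], []; simpl; tauto.
- destruct IH as (G1 & G2 & H1 & H2 & H); [intros x Hx; apply HG; now right|].
  destruct (HG y (or_introl eq_refl)) as [y Hy|y Hy].
  + exists (y :: G1), G2; repeat split; auto.
    * intros x [<-|Hx]; auto.
    * intros x [<-|Hx]; [now left|right; auto].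
  + exists G1, (y :: G2); repeat split; auto.
    * intros x [<-|Hx]; auto.
    * intros x Hx; apply in_or_app.
      destruct Hx as [<-|Hx]; [right; now left|].
      destruct (in_app_or _ _ _ (H x Hx)); [now left|right; now right].
Qed.

Lemma occurs_big_and (p : nat) (G : list formula) :
  occurs p (big_and G) -> exists x, List.In x G /\ occurs p x.
Proof.
induction G as [|y G IH]; simpl; [tauto|].
intros [Hy|HG]; [now exists y; auto|].
destruct (IH HG) as (x & Hx & Hp); exists x; auto.
Qed.

Lemma PPle_EIP : EIP PPle.
Proof.
intros Phi Psi phi HD.
destruct (PPle_elim _ _ HD) as [G [HG Hle]].
destruct (list_split_union _ _ _ HG) as (G1 & G2 & H1 & H2 & H12).
exists (Singleton (Imp (big_and G2) phi)); split; [|split].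
- intros _ [] p [Hp|Hp].
  + destruct (occurs_big_and _ _ Hp) as (x & Hx & Hpx).
    exists x; split; [left; auto|assumption].
  + exists phi; split; [right; constructor|assumption].
- intros _ []; apply PPle_intro with G1; [assumption|intros v].
  apply imp6_residual, le6_trans with (2 := Hle v).
  apply le6_big_and; intros x Hx.
  destruct (proj1 (meet6_glb _ _ _) (le6_refl
    (meet6 (eval PP6 v (big_and G1)) (eval PP6 v (big_and G2))))) as [L1 L2].
  destruct (in_app_or _ _ _ (H12 x Hx)) as [Hx1|Hx2].
  + exact (proj1 (le6_big_and _ _ _) L1 x Hx1).
  + exact (proj1 (le6_big_and _ _ _) L2 x Hx2).
- apply PPle_intro with (Imp (big_and G2) phi :: G2).
  + intros x [<-|Hx]; [left; constructor|right; auto].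
  + intros v; apply imp6_residual, le6_refl.
Qed.

(** * Failure of Craig and Maehara interpolation *)

Definition Iff (a b : formula) : formula := And (Imp a b) (Imp b a).

(* [Circ] of an element of [PP6] also holds at [FF], whence the second conjunct;
   the value is [TT] if [a] and [b] have the same value and [FF] otherwise. *)
Definition CrispEq (a b : formula) : formula := And (Circ (Iff a b)) (Iff a b).

(** [And x (Neg x)] fixes n and b and is at most f elsewhere, so two such terms meet above f only if
    both variables are n or both are b; the last conjunct then drops to FF. *)
Definition cip_left : formula :=
  And (And (And (Var 0) (Neg (Var 0))) (And (Var 1) (Neg (Var 1))))
      (Neg (CrispEq (Var 0) (Var 1))).

(** The first disjunct settles [Var 2] at FF or TT; otherwise, with [Var 0] at least f, both
    implications are at least f. *)
Definition cip_right : formula := Or (Circ (Var 2)) (Iff (Var 2) (Var 0)).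

Lemma cip_left_entails_right : PPle (Singleton cip_left) cip_right.
Proof.
apply PPle_intro with [cip_left].
- intros x [<-|[]]; constructor.
- intros v; simpl; destruct (v 0), (v 1), (v 2); reflexivity.
Qed.

Definition in_FF_n_TT (x : V6) : Prop := x = vFF \/ x = vn \/ x = vTT.

Lemma eval_in_FF_n_TT (v : nat -> PP6) (s : formula) :
  (forall p, occurs p s -> in_FF_n_TT (v p)) -> in_FF_n_TT (eval PP6 v s).
Proof.
unfold in_FF_n_TT.
induction s as [p|a IHa b IHb|a IHa b IHb|a IHa b IHb|a IHa|a IHa| |];
  simpl; intros Hv; auto;
  try (destruct IHa as [-> | [-> | -> ] ]; auto);
  try (destruct IHb as [-> | [-> | -> ] ]; auto);
  cbv; auto.
Qed.

Lemma PPle_not_CIP : ~ CIP PPle.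
Proof.
intros H.
destruct (H (Singleton cip_left) cip_right) as (Pi & Hvar & Hleft & Hright).
- exists 0; split; [exists cip_left|exists cip_right];
    (split; [constructor|simpl; tauto]).
- exact cip_left_entails_right.
- set (v := fun p => match p with 0 => vn | _ => vb end : PP6).
  (* Each member of [Pi] is at least f and lies in {FF, n, TT}, so it is at least n, whereas
     [cip_right] is f. *)
  cut (le6 vn (eval PP6 v cip_right) = true); [discriminate|].
  apply (PPle_sound Pi); [exact Hright|].
  intros x Hx.
  assert (Hf : le6 vf (eval PP6 v x) = true).
  { apply (PPle_sound (Singleton cip_left)); [now apply Hleft|].
    now intros _ []. }
  assert (Hs : in_FF_n_TT (eval PP6 v x)).
  { apply eval_in_FF_n_TT; intros p Hp.
    destruct (Hvar x Hx p Hp) as [p [y [[] Hl]] [z [[] Hr]]].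
    simpl in Hl, Hr; unfold in_FF_n_TT.
    destruct p as [|[|p]]; simpl; intuition discriminate. }
  now destruct Hs as [E|[E|E]]; rewrite E in *.
Qed.

Lemma MIP_CIP (D : logic) :
  (forall Phi Phi' psi, Included Phi Phi' -> D Phi psi -> D Phi' psi) ->
  MIP D -> CIP D.
Proof.
intros mono HM Phi phi [p Hp] HD.
set (E := Empty_set formula).
(* Union with [E] changes a set only up to extensional equality, hence this equivalence and the uses
   of [mono]. *)
assert (Hprops : forall q, props (Singleton phi) q <->
                           props (Union E (Singleton phi)) q).
{ intros q; split; intros (x & Hx & Hq); exists x; split; auto.
  - now right.
  - now destruct Hx as [x []|x Hx]. }
destruct (HM Phi E phi) as (Pi & Hvar & Hleft & Hright).
- exists p; destruct Hp as [p Hp1 Hp2]; split; [assumption|now apply Hprops].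
- apply (mono Phi); [|assumption]. intros x Hx; now left.
- exists Pi; split; [|split; [assumption|]].
  + intros x Hx q Hq; destruct (Hvar x Hx q Hq) as [q Hq1 Hq2].
    split; [assumption|now apply Hprops].
  + apply (mono (Union Pi E)); [|assumption].
    now intros _ [x Hx|x []].
Qed.

Theorem theorem8p2 : EIP PPle /\ ~ CIP PPle /\ ~ MIP PPle.
Proof.
split; [exact PPle_EIP|split; [exact PPle_not_CIP|]].
intros HM; exact (PPle_not_CIP (MIP_CIP PPle PPle_mono HM)).
Qed.
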